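(* For all real numbers $[f],[g],[w]\in\mathcal{S}_{\mathbb{R}}$ we have $([f]+[g])*[w]=([f]*[w])+([g]*[w])$.
   Context: Conventions. $\omega=\{0,1,2,\dots\}$, $\omega_+=\omega\setminus\{0\}$, $[a,b]_\omega=\{n\in\omega:a\le n\le b\}$, $[a,\infty]_\omega=\{n\in\omega:n\ge a\}$; empty products equal $1$. A system function $\vartheta:\omega_+\to[2,\infty]_\omega$ is fixed. Contractions. For $f:\omega\to\omega$ and $n\in\omega_+$, the contraction $c_n$ is applicable to $f$ iff $f(n+1)\ge\vartheta(n)$, and then $c_n(f)(n)=f(n)+1$, $c_n(f)(n+1)=f(n+1)-\vartheta(n)$, $c_n(f)(k)=f(k)$ for other $k$. A sequence of contractions is a finite (possibly empty) composition of contractions; it is applicable to $f$ iff each contraction in turn is applicable to the result of the preceding ones. Sign. For $f:\omega\to\omega$, $\sigma(f)=0$ if $f(0)$ is odd and $\sigma(f)=1$ if $f(0)$ is even. Auxiliary functions. $h:\omega\to\omega$ is a primary auxiliary function ($h\in A_p$) if $h(k)<\vartheta(k-1)$ for all $k\ge2$ and for every $N\in\omega_+$ there is $M\ge N+1$ with $h(M)\ne\vartheta(M-1)-1$. It is a secondary auxiliary function ($h\in A_s$) if $h(k)<\vartheta(k-1)$ for all $k\ge2$ and there is $N\in\omega_+$ with $h(M)=\vartheta(M-1)-1$ for all $M\ge N+1$; the least such $N$ is $N^h_{\min}$. Base set. $W_1$ is the set of pairs $(h_p,h_s)\in A_p\times A_s$ such that, with $N=N^{h_s}_{\min}$, $h_p(k)=h_s(k)$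 for $k<N$, $h_p(N)=h_s(N)+1$, and $h_p(k)=0$ for $k>N$. Two pairs in $W_1$ are equivalent if their first components agree on $\omega_+$ and have the same sign; $F$ is the collection of sets obtained by taking, for each equivalence class, the set of all functions that are components of its pairs. $W_2$ is the set of primary auxiliary functions occurring in no pair of $W_1$; two elements of $W_2$ are equivalent if they agree on $\omega_+$ and have the same sign; $G_2$ is the set of equivalence classes. The base set is $B=F\cup G_2$. Real numbers. For $b\in B$, $r_b$ is the set of $f:\omega\to\omega$ for which there is $h\in b$ such that for every $N\in\omega_+$ some sequence of contractions $\mathcal{C}$ applicable to $f$ satisfies $\mathcal{C}(f)(n)=h(n)$ for all $n\in[0,N]_\omega$. Let $b_1,b_2\in B$ be the elements containing respectively the zero function, and the function with value $1$ at $0$ and $0$ elsewhere. $\mathcal{S}_{\mathbb{R}}$ (the set of real numbers) consists of all $r_b$ with $b\in B\setminus\{b_1,b_2\}$ together with $[0]:=r_{b_1}\cup r_{b_2}$. Put $\mathcal{S}_{\mathbb{R}}^*=\mathcal{S}_{\mathbb{R}}\setminus\{[0]\}$. Distinct real numbers are disjoint. A function lying in some real number is called finite, and $[f]$ denotes the real number containing $f$. For $[a]\in\mathcal{S}_{\mathbb{R}}^*$ all elements have the same sign, denoted $\sigma([a])$. Every real number $[x]$ contains primary auxiliary functions, and they all agree on $\omega_+$; $x_p$ denotes one of them. Order. For $[a],[b]\in\mathcal{S}_{\mathbb{R}}^*$, $[a]\le[b]$ iff one of the following holds: (i) $\sigma([a])<\sigma([b])$; (ii) $\sigma([a])=\sigma([b])=1$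 and for every $a\in[a]$ there is $b\in[b]$ with $a(n)\le b(n)$ for all $n\in\omega_+$; (iii) $\sigma([a])=\sigma([b])=0$ and for every $b\in[b]$ there is $a\in[a]$ with $a(n)\ge b(n)$ for all $n\in\omega_+$. For $[a]\in\mathcal{S}_{\mathbb{R}}^*$, $[a]\le[0]$ iff $\sigma([a])=0$, and $[0]\le[a]$ iff $\sigma([a])=1$. Finally $[0]\le[0]$ holds. Strict order: $[a]<[b]$ iff not $[b]\le[a]$. Addition. The absolute value $|f|$ of $f:\omega\to\omega$ is the function with $|f|(0)=0$ and $|f|(k)=f(k)$ for $k\in\omega_+$; for a real number, $|[x]|:=[|f|]$ for any $f\in[x]$ (independent of $f$). For finite $f,g$ with $|[f]|>|[g]|$, the set of tracking functions $\mathcal{T}^f_g$ consists of all $\varrho:\omega\to\omega$ for which there is $w\in[f]$ with $w(n)\ge g(n)$ for all $n\in\omega_+$, $\varrho(0)=w(0)$ and $\varrho(n)=w(n)-g(n)$ for all $n\in\omega_+$. If moreover $\sigma(f)\ne\sigma(g)$ or $g\in[0]$, then $\mathcal{T}^f_g$ is non-empty and contained in a single real number $[x]$, and the primary tracking function $\varrho^f_g$ is defined by $\varrho^f_g(0)=f(0)$, $\varrho^f_g(k)=x_p(k)$ for $k\in\omega_+$. For finite $f,g$ the sub-sum $f+g:\omega\to\omega$ is: if $\sigma(f)=\sigma(g)$ and $f,g\notin[0]$, then $(f+g)(0)=f(0)g(0)$ and $(f+g)(k)=f(k)+g(k)$ for $k\in\omega_+$; otherwise $f+g$ is the zero function if $|[f]|=|[g]|$,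 is $\varrho^f_g$ if $|[f]|>|[g]|$, and is $\varrho^g_f$ if $|[f]|<|[g]|$. Addition of real numbers: $[f]+[g]:=[f+g]$ for any $f\in[f]$, $g\in[g]$ (independent of the choice of representatives). Multiplication. For $a,b\in\omega$ let $\Upsilon(a,b)=\max\{a,b\}-\min\{a,b\}$. For $n,k,K\in\omega_+$ let $$R(n,k,K)=\max\Big\{t\in\omega:\ t\prod_{j=1}^{n-1}\vartheta(j)\prod_{j=1}^{k-1}\vartheta(j)\le\prod_{j=1}^{K-1}\vartheta(j)\Big\}.$$ The rest function is $r(n,k,1)=R(n,k,1)$ and $r(n,k,M)=\Upsilon\big(R(n,k,M),\ \vartheta(M-1)R(n,k,M-1)\big)$ for $M\ge2$. For finite $f,g$ the sub-product $f*g:\omega\to\omega$ is $(f*g)(0)=f(0)+g(0)$ and $(f*g)(M)=\sum_{n=1}^M\sum_{k=1}^M f(n)g(k)\,r(n,k,M)$ for $M\in\omega_+$. Multiplication of real numbers: $[f]*[g]:=[f*g]$ for any $f\in[f]$, $g\in[g]$ (independent of the choice of representatives). *)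

(* Defs.v *)
From mathcomp Require Import all_boot.
From mathcomp Require Import boolp classical_sets.

Set Implicit Arguments.
Unset Strict Implicit.
Unset Printing Implicit Defensive.

Local Open Scope classical_set_scope.

(* The system function is theta : nat -> nat, with values at least 2 on positive
   arguments; theta 0 is never used. *)

Definition eq_pos (f g : nat -> nat) : Prop := forall n, 0 < n -> f n = g n.

Definition le_pos (f g : nat -> nat) : Prop := forall n, 0 < n -> f n <= g n.

Definition sgn (f : nat -> nat) : nat := if odd (f 0) then 0 else 1.

Definition same_class (f g : nat -> nat) : Prop := eq_pos f g /\ sgn f = sgn g.

Definition contract (theta : nat -> nat) (f : nat -> nat) (n : nat) : nat -> nat :=
  fun k => if k == n then (f n).+1
           else if k == n.+1 then f n.+1 - theta n
           else f k.

(* A sequence of contractions is the list of its indices, the head acting first. *)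
Fixpoint applicable (theta : nat -> nat) (s : seq nat) (f : nat -> nat) : bool :=
  if s is n :: s' then
    [&& 0 < n, theta n <= f n.+1 & applicable theta s' (contract theta f n)]
  else true.

Definition contract_seq (theta : nat -> nat) (s : seq nat) (f : nat -> nat) :
  nat -> nat := foldl (contract theta) f s.

Definition digits (theta : nat -> nat) (h : nat -> nat) : Prop :=
  forall k, 2 <= k -> h k < theta k.-1.

Definition max_tail (theta : nat -> nat) (h : nat -> nat) (N : nat) : Prop :=
  forall M, N.+1 <= M -> h M = theta M.-1 - 1.

Definition primary (theta : nat -> nat) : set (nat -> nat) :=
  [set h | digits theta h /\
    forall N, 0 < N -> exists M, N.+1 <= M /\ h M <> theta M.-1 - 1].

Definition secondary (theta : nat -> nat) : set (nat -> nat) :=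
  [set h | digits theta h /\ exists N, 0 < N /\ max_tail theta h N].

Definition is_Nmin (theta : nat -> nat) (h : nat -> nat) (N : nat) : Prop :=
  [/\ 0 < N, max_tail theta h N &
      forall N', 0 < N' -> max_tail theta h N' -> N <= N'].

Definition W1 (theta : nat -> nat) : set ((nat -> nat) * (nat -> nat)) :=
  [set p | [/\ primary theta p.1, secondary theta p.2 &
    exists N, [/\ is_Nmin theta p.2 N,
                  forall k, k < N -> p.1 k = p.2 k,
                  p.1 N = (p.2 N).+1 &
                  forall k, N < k -> p.1 k = 0]]].

Definition F (theta : nat -> nat) : set (set (nat -> nat)) :=
  [set b | exists2 p, W1 theta p &
    b = [set h | exists q, [/\ W1 theta q, same_class q.1 p.1 &
                               h = q.1 \/ h = q.2]]].

Definition W2 (theta : nat -> nat) : set (nat -> nat) :=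
  [set h | primary theta h /\ forall p, W1 theta p -> h <> p.1 /\ h <> p.2].

Definition G2 (theta : nat -> nat) : set (set (nat -> nat)) :=
  [set b | exists2 h, W2 theta h & b = [set h' | W2 theta h' /\ same_class h' h]].

Definition base (theta : nat -> nat) : set (set (nat -> nat)) :=
  F theta `|` G2 theta.

Definition r_of (theta : nat -> nat) (b : set (nat -> nat)) : set (nat -> nat) :=
  [set f | exists2 h, b h & forall N, 0 < N ->
    exists s, applicable theta s f /\
      forall n, n <= N -> contract_seq theta s f n = h n].

Definition zero_fun : nat -> nat := fun _ => 0.

Definition neg_zero_fun : nat -> nat := fun n => if n == 0 then 1 else 0.

Definition zeroR (theta : nat -> nat) : set (nat -> nat) :=
  [set f | exists b, [/\ base theta b, b zero_fun \/ b neg_zero_fun & r_of theta b f]].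

Definition SR (theta : nat -> nat) : set (set (nat -> nat)) :=
  [set x | (exists b, [/\ base theta b, ~ b zero_fun, ~ b neg_zero_fun &
                          x = r_of theta b])
           \/ x = zeroR theta].

(* [f]; the junk value for f not finite is the empty set *)
Definition cls (theta : nat -> nat) (f : nat -> nat) : set (nat -> nat) :=
  xget set0 [set x | SR theta x /\ x f].

(* Arbitrary representative: operations on real numbers that do not depend on
   representatives are defined by applying them to this one. *)
Definition rep (x : set (nat -> nat)) : nat -> nat := xget zero_fun x.

Definition sgnR (x : set (nat -> nat)) : nat := sgn (rep x).

Definition leR (theta : nat -> nat) (x y : set (nat -> nat)) : Prop :=
  [\/ [/\ x <> zeroR theta, y <> zeroR theta &
        [\/ sgnR x < sgnR y,
            [/\ sgnR x = 1, sgnR y = 1 &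
                forall a, x a -> exists2 b, y b & le_pos a b] |
            [/\ sgnR x = 0, sgnR y = 0 &
                forall b, y b -> exists2 a, x a & le_pos b a]]],
      [/\ x <> zeroR theta, y = zeroR theta & sgnR x = 0],
      [/\ x = zeroR theta, y <> zeroR theta & sgnR y = 1] |
      x = zeroR theta /\ y = zeroR theta].

Definition ltR (theta : nat -> nat) (x y : set (nat -> nat)) : Prop :=
  ~ leR theta y x.

Definition abs_fun (f : nat -> nat) : nat -> nat :=
  fun k => if k == 0 then 0 else f k.

Definition absR (theta : nat -> nat) (x : set (nat -> nat)) : set (nat -> nat) :=
  cls theta (abs_fun (rep x)).

Definition tracking (theta : nat -> nat) (f g : nat -> nat) : set (nat -> nat) :=
  [set rho | exists w, [/\ cls theta f w, le_pos g w, rho 0 = w 0 &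
                           forall n, 0 < n -> rho n = w n - g n]].

Definition trackingR (theta : nat -> nat) (f g : nat -> nat) : set (nat -> nat) :=
  xget set0 [set x | SR theta x /\ tracking theta f g `<=` x].

Definition primary_rep (theta : nat -> nat) (x : set (nat -> nat)) : nat -> nat :=
  xget zero_fun [set h | primary theta h /\ x h].

Definition primary_tracking (theta : nat -> nat) (f g : nat -> nat) : nat -> nat :=
  fun k => if k == 0 then f 0 else primary_rep theta (trackingR theta f g) k.

(* The last branch is the case |[f]| < |[g]|, the order being total. *)
Definition sub_sum (theta : nat -> nat) (f g : nat -> nat) : nat -> nat :=
  if `[< [/\ sgn f = sgn g, ~ zeroR theta f & ~ zeroR theta g] >] then
    fun k => if k == 0 then f 0 * g 0 else f k + g k
  else if `[< absR theta (cls theta f) = absR theta (cls theta g) >] then zero_fun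
  else if `[< ltR theta (absR theta (cls theta g)) (absR theta (cls theta f)) >] then
    primary_tracking theta f g
  else primary_tracking theta g f.

Definition addR (theta : nat -> nat) (x y : set (nat -> nat)) : set (nat -> nat) :=
  cls theta (sub_sum theta (rep x) (rep y)).

Definition Upsilon (a b : nat) : nat := maxn a b - minn a b.

(* Any t satisfying the inequality is at most the right-hand product (theta being
   positive), so the bound on t only makes the range finite. *)
Definition Rmax (theta : nat -> nat) (n k K : nat) : nat :=
  \max_(t < (\prod_(1 <= j < K) theta j).+1 |
        t * (\prod_(1 <= j < n) theta j) * (\prod_(1 <= j < k) theta j)
          <= \prod_(1 <= j < K) theta j) t.

Definition rest (theta : nat -> nat) (n k M : nat) : nat :=
  if M == 1 then Rmax theta n k 1
  else Upsilon (Rmax theta n k M) (theta M.-1 * Rmax theta n k M.-1).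

Definition sub_prod (theta : nat -> nat) (f g : nat -> nat) : nat -> nat :=
  fun M => if M == 0 then f 0 + g 0
           else \sum_(1 <= n < M.+1) \sum_(1 <= k < M.+1) f n * g k * rest theta n k M.

Definition mulR (theta : nat -> nat) (x y : set (nat -> nat)) : set (nat -> nat) :=
  cls theta (sub_prod theta (rep x) (rep y)).

(* Main.v *)
Require Import Defs.
From mathcomp Require Import all_boot.
From mathcomp Require Import boolp classical_sets.
From mathcomp Require Import all_order all_algebra.
From mathcomp Require Import reals topology normedtype sequences.
From mathcomp Require Import Rstruct.
From mathcomp Require Import zify ring.

Set Implicit Arguments.
Unset Strict Implicit.
Unset Printing Implicit Defensive.

Import Order.TTheory GRing.Theory Num.Theory.
Import numFieldNormedType.Exports.

(** The value of [f] is the sum of the series [f n / (theta 1 ... theta (n-1))],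
    [n >= 1].  A contraction does not change the value and moves mass to smaller
    indices; conversely, normalizing longer and longer prefixes of [f] produces a
    digit expansion of its value.  An auxiliary function is a digit expansion, and
    two of them have the same value exactly when they agree or form a pair of
    [W1] (like 1 and 0.999...), up to the entry at 0.  Hence the base set is in
    bijection with the pairs (sign, value), and the real numbers of the paper are
    the classes of functions with a given signed value [y] in R.  Under this
    correspondence [addR] and [mulR] are addition and multiplication in R: the
    rest function lists digits of [1 / (theta 1 ... theta (n-1) * theta 1 ...
    theta (k-1))]. *)

(** * Contractions and carrying, on integer numerators of partial sums *)

Section Numerators.

Context (theta : nat -> nat) (htheta : forall n : nat, 0 < n -> 2 <= theta n).

Definition den (N : nat) : nat := \prod_(1 <= j < N) theta j.

Lemma den1 : den 1 = 1.
Proof. by rewrite /den big_geq. Qed.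

Lemma denS N : 0 < N -> den N.+1 = den N * theta N.
Proof. by move=> N0; rewrite /den big_nat_recr. Qed.

Lemma den_gt0 N : 0 < den N.
Proof.
elim: N => [|[|N] IH]; rewrite ?den1 //; first by rewrite /den big_geq.
by rewrite denS // muln_gt0 IH (leq_trans _ (htheta _)).
Qed.

Lemma leq_den N : N <= den N.
Proof.
elim: N => [//|[|N] IH]; first by rewrite den1.
rewrite denS //.
have := htheta (ltn0Sn N); have := den_gt0 N.+1; nia.
Qed.

Lemma leq_den2 m n : m <= n -> den m <= den n.
Proof.
elim: n => [|n IH]; first by rewrite leqn0 => /eqP ->.
rewrite leq_eqVlt => /predU1P[-> //|/IH le_mn].
case: n le_mn {IH} => [|n] le_mn.
  by apply: leq_trans le_mn _; rewrite /den !big_geq.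
rewrite denS //; have := htheta (ltn0Sn n); nia.
Qed.

(* The numerator of the partial sum f 1 / den 1 + ... + f N / den N over the
   common denominator den N. *)
Fixpoint num (f : nat -> nat) (N : nat) : nat :=
  if N is N'.+1 then num f N' * theta N' + f N'.+1 else 0.

Lemma numS f N : num f N.+1 = num f N * theta N + f N.+1.
Proof. by []. Qed.

Lemma eq_num f g N :
  (forall n, 0 < n <= N -> f n = g n) -> num f N = num g N.
Proof.
elim: N => [//|N IH] fg /=.
by rewrite IH => [|n /andP[n0 nN]]; rewrite ?fg ?n0 ?leqnn // leqW.
Qed.

(** The unit gained at [n] is visible in the partial sum ending at [n] only: from [n.+1] on, it is
    worth [theta n] units of the next position, which is exactly what was removed there. *)
Lemma num_contract f n N : 0 < n -> theta n <= f n.+1 ->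
  num (contract theta f n) N = num f N + (N == n).
Proof.
move=> n0 le_f; elim: N => [|N IH]; first by case: n n0 {le_f}.
rewrite !numS IH /contract eqSS.
have [->|nN] := eqVneq N n; first by rewrite gtn_eqF //; nia.
by have [->|] := eqVneq N.+1 n; nia.
Qed.

(** Mass only moves towards smaller indices, so prefixes can only gain. *)
Lemma contract_seq_prefix s f N :
  applicable theta s f -> num f N <= num (contract_seq theta s f) N.
Proof.
elim: s f => [//|n s IH] f /= /and3P[n0 le_f /IH]; apply: leq_trans.
by rewrite num_contract // leq_addr.
Qed.

(** A finite sequence touches finitely many indices; beyond all of them every gain is balanced by
    its loss, so the value of the series is preserved. *)
Lemma contract_seq_num_eventually s f : applicable theta s f ->
  exists K, forall N, K <= N -> num (contract_seq theta s f) N = num f N.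
Proof.
elim: s f => [|n s IH] f /=; first by exists 0.
case/and3P=> n0 le_f /IH[K eqK]; exists (maxn K n.+1) => N.
rewrite geq_max => /andP[KN nN].
rewrite -[contract_seq _ _ _]/(contract_seq theta s (contract theta f n)).
rewrite eqK // num_contract //.
by rewrite gtn_eqF // addn0.
Qed.

Lemma contract_seq0 s f :
  applicable theta s f -> contract_seq theta s f 0 = f 0.
Proof.
elim: s f => [//|n s IH] f /= /and3P[n0 le_f /IH].
by rewrite /contract_seq /= => ->; rewrite /contract ltn_eqF.
Qed.

Lemma applicable_cat s1 s2 f : applicable theta (s1 ++ s2) f =
  applicable theta s1 f && applicable theta s2 (contract_seq theta s1 f).
Proof. by elim: s1 f => [//|n s IH] f /=; rewrite IH !andbA. Qed.

Lemma contract_nseq n t f : 0 < n -> t * theta n <= f n.+1 ->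
  applicable theta (nseq t n) f /\
  forall k, contract_seq theta (nseq t n) f k =
    if k == n then f n + t else if k == n.+1 then f n.+1 - t * theta n else f k.
Proof.
move=> n0; elim: t f => [|t IH] f le_f /=.
  by split=> // k; case: eqP => [->|_]; [rewrite addn0|case: eqP => [->|//]; lia].
have le_t : t * theta n <= contract theta f n n.+1.
  by rewrite /contract (gtn_eqF (ltnSn n)) eqxx; nia.
have [app eqc] := IH _ le_t; rewrite n0 app andbT; split; first by nia.
move=> k; rewrite /contract_seq /= -/(contract_seq _ _ _) eqc /contract.
rewrite eqxx (gtn_eqF (ltnSn n)) eqxx.
have [_|kn] := eqVneq k n; first by rewrite addSnnS.
by have [_|kn1] := eqVneq k n.+1; rewrite // mulSn subnDA.
Qed.

(** Carrying in mixed radix, from the top index downwards: reduce the last entry modulo its base,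
    add the quotient to the entry before it, and recurse on the shorter prefix. *)
Lemma normalize M f : exists s, [/\ applicable theta s f,
  forall n, M < n -> contract_seq theta s f n = f n,
  forall n, 2 <= n <= M -> contract_seq theta s f n < theta n.-1 &
  num (contract_seq theta s f) M = num f M].
Proof.
elim: M f => [|[|M] IH] f.
- by exists [::]; split=> // n; case: n => [|[]].
- by exists [::]; split=> // n; case: n => [|[]].
(* [t] is the carry: that many contractions at [M.+1] leave the remainder at [M.+2]. *)
pose t := f M.+2 %/ theta M.+1.
have th0 : 0 < theta M.+1 by apply: leq_trans (htheta _).
have [//|app eqc] := @contract_nseq M.+1 t f _ (leq_divM _ _).
have cat_eq s : foldl (contract theta) f (nseq t M.+1 ++ s) =
  contract_seq theta s (contract_seq theta (nseq t M.+1) f) by exact: foldl_cat.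
have app_eq s := applicable_cat (nseq t M.+1) s f.
move: (contract_seq _ _ _) cat_eq app_eq eqc; rewrite app => f' cat_eq app_eq eqc.
have [s [app_s eq_s dig_s num_s]] := IH f'.
have f'M : f' M.+2 = f M.+2 %% theta M.+1.
  by rewrite eqc gtn_eqF // eqxx /t {1}(divn_eq (f M.+2) (theta M.+1)) addKn.
exists (nseq t M.+1 ++ s); rewrite app_eq app_s /contract_seq cat_eq.
rewrite -/(contract_seq theta s f').
split=> // [n Mn|n /andP[n2]|].
- rewrite eq_s; last by lia.
  rewrite eqc; have /negPf -> : n != M.+1 by lia.
  by have /negPf -> : n != M.+2 by lia.
- rewrite leq_eqVlt => /predU1P[->|nM]; last by rewrite dig_s // n2.
  by rewrite eq_s // f'M ltn_mod.
rewrite numS num_s eq_s // numS /= eqc eqxx.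
rewrite (@eq_num f' f) => [|n /andP[n0 nM]]; last first.
  rewrite eqc; have /negPf -> : n != M.+1 by lia.
  by have /negPf -> : n != M.+2 by lia.
rewrite f'M; have := divn_eq (f M.+2) (theta M.+1); rewrite -/t.
by move: (_ %% _) => r ->; ring.
Qed.

(** Dividing the numerator by the last base gives the last digit as remainder and the shorter
    numerator as quotient. The entry at 1 is unbounded and absorbs the integer part. *)
Lemma digits_uniq g h N :
  (forall n, 2 <= n <= N -> g n < theta n.-1) ->
  (forall n, 2 <= n <= N -> h n < theta n.-1) ->
  num g N = num h N -> forall n, 0 < n <= N -> g n = h n.
Proof.
elim: N => [|N IH] dg dh; first by move=> _ [].
case: N => [|N] in IH dg dh *.
  by rewrite /= !mul0n !add0n => e [|[|n]].
rewrite numS (numS h) => e n /andP[n0]; have := dg N.+2; have := dh N.+2.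
rewrite !leqnn /= => /(_ isT) hN /(_ isT) gN.
have eq_N : num g N.+1 = num h N.+1.
  have th0 : 0 < theta N.+1 by apply: leq_trans (htheta _).
  move: (congr1 (divn^~ (theta N.+1)) e) => /=.
  by rewrite !divnMDl // !divn_small // !addn0.
rewrite leq_eqVlt => /predU1P[->|nN]; first by move: e; rewrite eq_N => /addnI.
apply: IH => // [m /andP[m2 mN]|m /andP[m2 mN]|]; last by rewrite n0.
  by apply: dg; rewrite m2 ltnW.
by apply: dh; rewrite m2 ltnW.
Qed.

Lemma num_add f g h N :
  (forall n, 0 < n -> f n = g n + h n) -> num f N = num g N + num h N.
Proof.
move=> fgh; elim: N => [//|N IH]; rewrite !numS IH fgh //; ring.
Qed.

Lemma leq_num f g N : le_pos f g -> num f N <= num g N.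
Proof.
move=> le_fg; elim: N => [//|N IH]; rewrite !numS leq_add ?le_fg //.
by rewrite leq_mul2r IH orbT.
Qed.

(** * The rest function as a digit sequence, and numerators of sub-products *)

Lemma ltn_den m n : 0 < m < n -> den m < den n.
Proof.
case/andP=> m0 /leq_den2; apply: leq_trans; rewrite denS //.
by have := htheta m0; have := den_gt0 m; nia.
Qed.

Lemma Rmax_divn n k K : Rmax theta n k K = den K %/ (den n * den k).
Proof.
have leE t : (t * den n * den k <= den K) = (t <= den K %/ (den n * den k)).
  by rewrite leq_divRL ?muln_gt0 ?den_gt0 // mulnA.
apply/eqP; rewrite eqn_leq; apply/andP; split.
  by apply/bigmax_leqP => t; rewrite leE.
have lt_q : den K %/ (den n * den k) < (den K).+1 by rewrite ltnS leq_div.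
by apply: (bigop.bigmax_sup (Ordinal lt_q)); rewrite //= leE.
Qed.

Lemma Rmax_small n k K : 0 < K -> (K < n) || (K < k) -> Rmax theta n k K = 0.
Proof.
move=> K0 lt_K; rewrite Rmax_divn divn_small //.
have := den_gt0 n; have := den_gt0 k; case/orP: lt_K => lt_K.
  by have := @ltn_den K n; rewrite K0 lt_K => /(_ isT); nia.
by have := @ltn_den K k; rewrite K0 lt_K => /(_ isT); nia.
Qed.

(** As [Rmax] is a floor, multiplying it by [theta M] cannot exceed the next floor. Hence [Upsilon]
    is an ordinary difference, and [rest] lists the digits whose numerators are the [Rmax]. *)
Lemma restS n k M : 0 < M ->
  theta M * Rmax theta n k M + rest theta n k M.+1 = Rmax theta n k M.+1.
Proof.
move=> M0; rewrite /rest /Upsilon eqSS (gtn_eqF M0) /=.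
have le_R : theta M * Rmax theta n k M <= Rmax theta n k M.+1.
  rewrite !Rmax_divn denS // leq_divRL ?muln_gt0 ?den_gt0 // -mulnA mulnC.
  by rewrite leq_mul2r leq_divM orbT.
by rewrite (maxn_idPl le_R) (minn_idPr le_R) subnKC.
Qed.

Lemma num_sub_prod f g N : num (sub_prod theta f g) N =
  \sum_(1 <= n < N.+1) \sum_(1 <= k < N.+1) f n * g k * Rmax theta n k N.
Proof.
elim: N => [|N IH]; first by rewrite big_geq.
case: N IH => [_|N IH].
  by rewrite numS mul0n add0n.
rewrite numS IH [sub_prod _ _ _ _]/=.
(* The new row and column have an index exceeding [N.+1], so their [Rmax] at level [N.+1] is 0; both
   sums then share one range and add termwise by [restS]. *)
have -> : \sum_(1 <= n < N.+2) \sum_(1 <= k < N.+2) f n * g k * Rmax theta n k N.+1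
   = \sum_(1 <= n < N.+3) \sum_(1 <= k < N.+3) f n * g k * Rmax theta n k N.+1.
  rewrite [RHS]big_nat_recr //= [X in _ = _ + X]big1 ?addn0 => [|k _].
    apply: eq_bigr => n _; rewrite [RHS]big_nat_recr //=.
    by rewrite Rmax_small ?ltnSn ?orbT // muln0 addn0.
  by rewrite Rmax_small ?ltnSn // muln0.
rewrite big_distrl -big_split; apply: eq_bigr => n _ /=.
rewrite big_distrl -big_split; apply: eq_bigr => k _ /=.
by rewrite -(restS n k (ltn0Sn N)) mulnDr -!mulnA [_ * theta _]mulnC.
Qed.

End Numerators.

(** * Partial sums in the reals and digit expansions of their limits *)

Section Values.

Context (theta : nat -> nat) (htheta : forall n : nat, 0 < n -> 2 <= theta n).
Context (R : realType).

Local Open Scope classical_set_scope.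
Local Open Scope ring_scope.

Local Notation den := (den theta).
Local Notation num := (num theta).

Definition psum (f : nat -> nat) (N : nat) : R := (num f N)%:R / (den N)%:R.

(** The next multiple of 1/[den N] above [psum f N]: a number in the interval from [psum f N] to
    [usum f N], right end excluded, has [num f N] as the floor of its [den N]-multiple. *)
Definition usum (f : nat -> nat) (N : nat) : R := (num f N).+1%:R / (den N)%:R.

Lemma denR_gt0 N : 0 < (den N)%:R :> R.
Proof. by rewrite ltr0n den_gt0. Qed.

Lemma den_psum f N : psum f N * (den N)%:R = (num f N)%:R.
Proof. by rewrite /psum divfK // gt_eqF ?denR_gt0. Qed.

Lemma den_usum f N : usum f N * (den N)%:R = (num f N).+1%:R.
Proof. by rewrite /usum divfK // gt_eqF ?denR_gt0. Qed.

Lemma usumE f N : usum f N = psum f N + (den N)%:R^-1.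
Proof. by rewrite /usum /psum -addn1 natrD mulrDl mul1r. Qed.

Lemma psumS f N : psum f N.+1 = psum f N + (f N.+1)%:R / (den N.+1)%:R.
Proof.
case: N => [|N]; first by rewrite /psum /= mul0n add0n mul0r add0r.
have th0 : (theta N.+1)%:R != 0 :> R.
  by rewrite pnatr_eq0 -lt0n (leq_trans _ (htheta _)).
rewrite /psum numS denS // natrD !natrM; have /gt_eqF d0 := denR_gt0 N.+1.
by field; rewrite th0 d0.
Qed.

Lemma psum_ge0 f N : 0 <= psum f N.
Proof. by rewrite divr_ge0 ?ler0n. Qed.

Lemma nondecreasing_psum f : nondecreasing_seq (psum f).
Proof.
by apply/nondecreasing_seqP => N; rewrite psumS lerDl divr_ge0 ?ler0n.
Qed.

Lemma psum_le_lim f (x : R) N : psum f @ \oo --> x -> psum f N <= x.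
Proof.
move=> fx; have <- := cvg_lim (@Rhausdorff _) fx.
by apply: nondecreasing_cvgn_le; [exact: nondecreasing_psum|exact: cvgP fx].
Qed.

Lemma lim_psum_le f (x B : R) : psum f @ \oo --> x ->
  (forall N, psum f N <= B) -> x <= B.
Proof. by move=> fx le_B; apply: cvgr_to_le fx _; near=> N; exact: le_B.
Unshelve. all: by end_near. Qed.

Lemma lim_psum_ge0 f (x : R) : psum f @ \oo --> x -> 0 <= x.
Proof. by move/(psum_le_lim 0); apply: le_trans; exact: psum_ge0. Qed.

Lemma bounded_psum_cvg f (B : R) : (forall N, psum f N <= B) ->
  exists x : R, psum f @ \oo --> x.
Proof.
move=> le_B; exists (sup (range (psum f))); apply: nondecreasing_cvgn.
  exact: nondecreasing_psum.
by exists B => _ [N _ <-].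
Qed.

Lemma psum_cvg_unique f (x y : R) :
  psum f @ \oo --> x -> psum f @ \oo --> y -> x = y.
Proof. by move=> fx fy; apply: (cvg_unique _ fx fy). Qed.

Lemma eq_pos_psum f g : eq_pos f g -> psum f = psum g.
Proof.
move=> fg; apply/funext => N; rewrite /psum (@eq_num _ f g) // => n /andP[n0 _].
exact: fg.
Qed.

Lemma inv_den_cvg0 : (fun N => (den N)%:R^-1 : R) @ \oo --> (0 : R).
Proof.
rewrite -(cvg_shiftS _ (nbhs (0 : R))); apply: squeeze_cvgr (cvg_cst _) cvg_harmonic.
near=> N; rewrite invr_ge0 ler0n /= lef_pV2 ?posrE ?denR_gt0 // ler_nat.
exact: leq_den.
Unshelve. all: by end_near. Qed.

Lemma squeeze_psum f (x : R) :
  (forall N, (0 < N)%N -> psum f N <= x <= usum f N) -> psum f @ \oo --> x.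
Proof.
move=> fx; apply: (@squeeze_cvgr _ _ _ _ (fun N => x - (den N)%:R^-1) (fun=> x)).
- near=> N; have /fx/andP[-> ] : (0 < N)%N by near: N; exists 1%N.
  by rewrite usumE andbT lerBlDr.
- by rewrite -[X in _ --> X]subr0; apply: cvgB; [exact: cvg_cst|exact: inv_den_cvg0].
- exact: cvg_cst.
Unshelve. all: by end_near. Qed.

(** The upper bounds decrease along digits, strictly unless the digit is maximal. The equality case
    is what later separates primary from secondary functions. *)
Lemma usum_step f N : (0 < N)%N -> (f N.+1 < theta N)%N ->
  usum f N.+1 <= usum f N ?= iff (f N.+1 == theta N - 1)%N.
Proof.
move=> N0 lt_f; have d0 := denR_gt0 N.+1.
have eq_u : usum f N = ((num f N).+1 * theta N)%:R / (den N.+1)%:R.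
  have th0 : (theta N)%:R != 0 :> R.
    by rewrite pnatr_eq0 -lt0n (leq_ltn_trans _ lt_f).
  rewrite /usum denS // !natrM; have /gt_eqF := denR_gt0 N => dN0.
  by field; rewrite th0 dN0.
rewrite eq_u /usum numS; split.
  by rewrite ler_pM2r ?invr_gt0 // ler_nat; nia.
have dn : (den N.+1)%:R^-1 != 0 :> R by rewrite invr_eq0 gt_eqF.
by rewrite (inj_eq (mulIf dn)) eqr_nat; apply/eqP/eqP; nia.
Qed.

Lemma usum_le f N M : (0 < N <= M)%N ->
  (forall n, (2 <= n <= M)%N -> (f n < theta n.-1)%N) -> usum f M <= usum f N.
Proof.
case/andP=> N0; elim: M => [|M IH]; first by rewrite leqNgt N0.
rewrite leq_eqVlt => /predU1P[-> //|NM] df.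
apply: le_trans (IH NM _) => [|n /andP[n2 nM]]; last by rewrite df // n2 leqW.
by apply: usum_step; [exact: leq_trans N0 NM|apply: (df M.+1); lia].
Qed.

Lemma nat_floor_uniq (a b : nat) (x : R) :
  a%:R <= x < a.+1%:R -> b%:R <= x < b.+1%:R -> a = b.
Proof.
case/andP=> ax xa /andP[bx xb].
have : (a%:R < b.+1%:R :> R) by exact: le_lt_trans xb.
have : (b%:R < a.+1%:R :> R) by exact: le_lt_trans xa.
by rewrite !ltr_nat; lia.
Qed.

Lemma num_uniq f g (x : R) N :
  psum f N <= x < usum f N -> psum g N <= x < usum g N -> num f N = num g N.
Proof.
have d0 := denR_gt0 N; have H h : psum h N <= x < usum h N ->
    (num h N)%:R <= x * (den N)%:R < (num h N).+1%:R.
  by rewrite -den_psum -den_usum ler_pM2r // ltr_pM2r.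
by move=> /H fx /H gx; exact: nat_floor_uniq fx gx.
Qed.

Lemma psum_lt_usum f N : psum f N < usum f N.
Proof. by rewrite usumE ltrDl invr_gt0 denR_gt0. Qed.

(* A digit expansion approximated from below by f is reached from f by
   normalizing long enough prefixes of f. *)
Lemma contract_to_digits f h : digits theta h -> f 0%N = h 0%N ->
  (forall N, (0 < N)%N -> exists2 M, (N <= M)%N & psum h N <= psum f M < usum h N) ->
  forall N, (0 < N)%N -> exists s, applicable theta s f /\
      forall n, (n <= N)%N -> contract_seq theta s f n = h n.
Proof.
move=> dh f0 approx N N0; have [M NM fM] := approx N N0.
have [s [app_s _ dig_s num_s]] := normalize htheta M f.
exists s; split=> // -[_|n nN]; first by rewrite contract_seq0.
set g := contract_seq _ _ _ in dig_s num_s *.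
apply: (digits_uniq htheta (N := N)) => // [m /andP[m2 mN]|m /andP[m2 mN]|].
- by rewrite dig_s // m2 (leq_trans mN).
- exact: dh.
(* Normalizing keeps the sum up to [M], and that sum lies between [psum g N] and [usum g N] because
   the entries of [g] up to [M] are digits; so [g] and [h] have the same floor at [N]. *)
apply: num_uniq fM; have -> : psum f M = psum g M by rewrite /psum num_s.
rewrite nondecreasing_psum //=; apply: lt_le_trans (psum_lt_usum _ _) _.
by apply: usum_le => //; rewrite N0.
Qed.

(** The digits come from floors of the terms [y M], not of the limit. If the terms stay strictly
    below a limit with a terminating expansion, this yields the expansion with a maximal tail, the
    only one that contractions of a function with partial sums [y] can reach. *)
Lemma digits_of_limit (y : nat -> R) (B : R) (c : nat) :
  nondecreasing_seq y -> (forall N, 0 <= y N <= B) ->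
  exists h, [/\ digits theta h, h 0%N = c & forall N, (0 < N)%N ->
    exists K, forall M, (K <= M)%N -> psum h N <= y M < usum h N].
Proof.
move=> nd_y y_bnd.
(* [a N] is the eventual floor of [y M * den N]: nondecreasing in [M] and bounded, this integer
   becomes constant. *)
have /choice[a aP] N : exists a, exists K, forall M, (K <= M)%N ->
    a%:R <= y M * (den N)%:R < a.+1%:R.
  have d0 := denR_gt0 N.
  pose P t := `[< exists M, t%:R <= y M * (den N)%:R >].
  have exP : exists t, P t.
    by exists 0%N; apply/asboolP; exists 0%N;
      rewrite mulr_ge0 ?ler0n; case/andP: (y_bnd 0%N).
  have ubP t : P t -> (t <= Num.truncn (B * (den N)%:R))%N.
    case/asboolP=> M le_t; have /andP[y0 yB] := y_bnd M.
    rewrite leqNgt truncn_lt_nat ?mulr_ge0 ?ler0n ?(le_trans y0) // -leNgt.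
    by apply: le_trans le_t _; rewrite ler_pM2r.
  case: (ex_maxnP exP ubP) => a /asboolP[K aK] maxa; exists a, K => M KM.
  rewrite (le_trans aK) ?ler_pM2r ?nd_y //= ltNge; apply/negP => lt_a.
  by have /maxa : P a.+1 by [apply/asboolP; exists M]; rewrite ltnn.
(* Floors at consecutive denominators are nested, so their difference is a digit below [theta N]. *)
have step N : (0 < N)%N -> (a N * theta N <= a N.+1 < (a N).+1 * theta N)%N.
  move=> N0; have [K1 H1] := aP N; have [K2 H2] := aP N.+1.
  have := H1 _ (leq_maxl K1 K2); have := H2 _ (leq_maxr K1 K2).
  rewrite denS // natrM mulrA; set z := _ * (den N)%:R => /andP[az za] /andP[bz zb].
  have th0 : 0 < (theta N)%:R :> R by rewrite ltr0n (leq_trans _ (htheta N0)).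
  apply/andP; split.
    rewrite -ltnS -(ltr_nat R) natrM; apply: le_lt_trans za.
    by rewrite ler_pM2r.
  by rewrite -(ltr_nat R) natrM; apply: le_lt_trans az _; rewrite ltr_pM2r.
(* The factor [(0 < j)] makes the entry at 1 the whole floor [a 1], with nothing subtracted. *)
pose h k := if k is j.+1 then (a j.+1 - (0 < j) * (a j * theta j))%N else c.
have num_h N : (0 < N)%N -> num h N = a N.
  case: N => // N _; elim: N => [|N IH]; first by rewrite /= mul0n subn0.
  by rewrite numS IH /= mul1n subnKC //; case/andP: (step N.+1 isT).
exists h; split=> // [[|[|k]] // _|N N0].
  by rewrite /h /= mul1n; have := step k.+1 isT; nia.
have [K aK] := aP N; exists K => M /aK; rewrite -(num_h N N0).
by rewrite -den_psum -den_usum ler_pM2r ?ltr_pM2r ?denR_gt0.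
Qed.

Lemma expansion_of_cvg (y : nat -> R) (x : R) (c : nat) :
  nondecreasing_seq y -> (forall N, 0 <= y N) -> y @ \oo --> x ->
  exists h, [/\ digits theta h, h 0%N = c, psum h @ \oo --> x &
    forall N, (0 < N)%N ->
      exists K, forall M, (K <= M)%N -> psum h N <= y M < usum h N].
Proof.
move=> nd_y y0 yx.
have y_le N : y N <= x.
  have <- := cvg_lim (@Rhausdorff _) yx.
  by apply: nondecreasing_cvgn_le => //; exact: cvgP yx.
have [|h [dh h0 hy]] := @digits_of_limit y x c nd_y; first by move=> N; rewrite y0 y_le.
exists h; split=> //; apply: squeeze_psum => N /hy[K hK]; apply/andP; split.
  by have /andP[+ _] := hK K (leqnn K); move/le_trans; apply.
by apply: cvgr_to_le yx _; exists K => // M /= /hK/andP[_ /ltW].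
Qed.

Lemma expansion (x : R) (c : nat) : 0 <= x ->
  exists h, [/\ digits theta h, h 0%N = c & psum h @ \oo --> x].
Proof.
move=> x0; have [|//|//|h [dh h0 hx _]] := @expansion_of_cvg (fun=> x) x c.
- by move=> m n _; exact: lexx.
- exact: cvg_cst.
by exists h.
Qed.

Lemma contract_to_expansion f (x : R) : psum f @ \oo --> x ->
  exists h, [/\ digits theta h, h 0%N = f 0%N, psum h @ \oo --> x &
   forall N, (0 < N)%N -> exists s, applicable theta s f /\
      forall n, (n <= N)%N -> contract_seq theta s f n = h n].
Proof.
move=> fx.
have [h [dh h0 hx hy]] :=
  expansion_of_cvg (f 0%N) (@nondecreasing_psum f) (psum_ge0 f) fx.
exists h; split=> //; apply: contract_to_digits => // N N0.
by have [K hK] := hy N N0; exists (maxn N K); rewrite ?leq_maxl // hK // leq_maxr.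
Qed.

(** Contractions raise prefixes but preserve sums far enough out, so the partial sums of [f] and [h]
    interleave and have the same supremum. *)
Lemma lim_of_contract f h (x : R) : psum h @ \oo --> x ->
  (forall N, (0 < N)%N -> exists s, applicable theta s f /\
      forall n, (n <= N)%N -> contract_seq theta s f n = h n) ->
  f 0%N = h 0%N /\ psum f @ \oo --> x.
Proof.
move=> hx red; split.
  have [s [app eq_s]] := red 1%N isT.
  by rewrite -(eq_s 0%N isT) contract_seq0.
have sandwich N : psum f N <= psum h N /\ exists M, psum h N <= psum f M.
  case: N => [|N]; first by rewrite /psum /= !mul0r; split=> //;
    exists 0%N; rewrite mul0r.
  have [s [app eq_s]] := red N.+1 isT.
  have eq_h : psum h N.+1 = psum (contract_seq theta s f) N.+1.
    by rewrite /psum; congr (_%:R / _); apply: eq_num => n /andP[_ /eq_s].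
  rewrite eq_h; split.
    by rewrite ler_pM2r ?invr_gt0 ?denR_gt0 // ler_nat contract_seq_prefix.
  have [K eq_K] := contract_seq_num_eventually app; exists (maxn N.+1 K).
  apply: le_trans (nondecreasing_psum _ (leq_maxl N.+1 K)) _.
  by rewrite /psum eq_K // leq_maxr.
have f_le N : psum f N <= x.
  by have [/le_trans le_h _] := sandwich N; apply: le_h; exact: psum_le_lim.
have [l fl] := bounded_psum_cvg f_le.
suff -> : x = l by [].
apply: le_anti; rewrite (lim_psum_le fl f_le) andbT.
apply: lim_psum_le hx _ => N; have [_ [M /le_trans]] := sandwich N; apply.
exact: psum_le_lim.
Qed.

End Values.

(** * Primary and secondary functions and their pairing in [W1] *)

Section AuxiliaryFunctions.

Context (theta : nat -> nat) (htheta : forall n : nat, 0 < n -> 2 <= theta n).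

Lemma eq_digits g h : eq_pos g h -> digits theta h -> digits theta g.
Proof. by move=> gh dh k k2; rewrite gh ?dh // ltnW. Qed.

Lemma eq_max_tail g h N : eq_pos g h -> max_tail theta h N -> max_tail theta g N.
Proof. by move=> gh dh M NM; rewrite gh ?dh // (leq_trans _ NM). Qed.

Lemma eq_primary g h : eq_pos g h -> primary theta h -> primary theta g.
Proof.
move=> gh [dh prim]; split; first exact: eq_digits dh.
move=> N /prim[M [NM neq]]; exists M; split=> //.
by rewrite gh // (leq_trans _ NM).
Qed.

Lemma eq_secondary g h : eq_pos g h -> secondary theta h -> secondary theta g.
Proof.
move=> gh [dh [N [N0 tail]]]; split; first exact: eq_digits dh.
by exists N; split=> //; exact: eq_max_tail tail.
Qed.

Lemma eq_posC g h : eq_pos g h -> eq_pos h g.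
Proof. by move=> gh n n0; rewrite gh. Qed.

Lemma primary_or_secondary h :
  digits theta h -> primary theta h \/ secondary theta h.
Proof.
move=> dh; have [[N [N0 tail]]|no_tail] := EM (exists N, 0 < N /\ max_tail theta h N).
  by right; split=> //; exists N.
left; split=> // N N0; apply: contrapT => no_M; apply: no_tail.
exists N; split=> // M NM; apply: contrapT => neq; apply: no_M.
by exists M.
Qed.

Lemma primary_not_secondary h : primary theta h -> ~ secondary theta h.
Proof.
by move=> [_ prim] [_ [N [/prim[M [NM neq]] tail]]]; apply: neq; exact: tail.
Qed.

Lemma eq_W1 p q p' q' : W1 theta (p, q) -> eq_pos p' p -> eq_pos q' q ->
  p' 0 = q' 0 -> W1 theta (p', q').
Proof.
case=> /= prim sec [N [[N0 tail minN] eq_lt eqN gtN]] p'p q'q e0; split=> /=.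
- exact: eq_primary prim.
- exact: eq_secondary sec.
exists N; split.
- split=> //; first exact: eq_max_tail tail.
  by move=> N' N'0 /(eq_max_tail (eq_posC q'q)); exact: minN.
- by move=> [|k] kN; rewrite // p'p // q'q // eq_lt.
- by rewrite p'p // q'q.
- by move=> k Nk; rewrite p'p ?gtN // (leq_ltn_trans _ Nk).
Qed.

Definition set_at0 (h : nat -> nat) (c : nat) : nat -> nat :=
  fun k => if k is k'.+1 then h k else c.

Lemma set_at0_pos h c : eq_pos (set_at0 h c) h.
Proof. by case. Qed.

(** The entry at 0 can be changed in both components at once, so a pair may be given either sign. *)
Lemma W1_eq_fst p q h : W1 theta (p, q) -> eq_pos h p ->
  W1 theta (h, set_at0 q (h 0)).
Proof. by move=> W hp; apply: eq_W1 W hp (set_at0_pos _ _) _. Qed.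

Lemma W1_at0 p q : W1 theta (p, q) -> p 0 = q 0.
Proof. by case=> _ _ [N [[N0 _ _] /(_ 0 N0)]]. Qed.

(** Rounding up: at the least start [N] of the maximal tail, add one to the entry and clear
    everything after it. *)
Lemma secondary_partner q : secondary theta q -> exists p, W1 theta (p, q).
Proof.
case=> dq [N1 [N10 tail1]].
pose P N := (0 < N) && `[< max_tail theta q N >].
have exP : exists N, P N by exists N1; rewrite /P N10; apply/asboolP.
case: (ex_minnP exP) => N /andP[N0 /asboolP tail] minN.
have minN' N' : 0 < N' -> max_tail theta q N' -> N <= N'.
  by move=> N'0 tail'; apply: minN; rewrite /P N'0; apply/asboolP.
pose p k := if k < N then q k else if k == N then (q N).+1 else 0.
have p_gt k : N < k -> p k = 0 by move=> Nk; rewrite /p ltnNge ltnW //= gtn_eqF.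
exists p; split=> /=; first 1 last.
- by split=> //; exists N1.
- exists N; split=> //.
  + by move=> k kN; rewrite /p kN.
  + by rewrite /p ltnn eqxx.
split.
  move=> k k2; have k1 : 0 < k.-1 by lia.
  rewrite /p; case: (ltngtP k N) => [kN|_|eqN]; first exact: dq.
    by have := htheta k1; lia.
  (* If the raised digit overflowed, the digit at [N] would already be maximal and the tail would
     start one place earlier, against minimality. *)
  rewrite -eqN ltn_neqAle dq // andbT; apply/eqP => qk.
  suff : N <= k.-1 by lia.
  apply: minN' => // M; rewrite prednK ?(ltnW k2) // leq_eqVlt => /predU1P[<-|].
    by rewrite -qk subn1.
  by rewrite eqN; exact: tail.
(* Beyond [N] the entries are 0, which is not maximal since each base is at least 2. *)
move=> K K0; exists (maxn N K).+1; rewrite ltnS leq_maxr; split=> //.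
rewrite p_gt; last by rewrite ltnS leq_maxl.
by have := @htheta (maxn N K); rewrite leq_max K0 orbT /= => /(_ isT); lia.
Qed.

(** The lead of one unit created at [N] persists: multiplied by [theta M], it is reduced by the
    maximal digit [theta M - 1] of [q] and is one unit again. *)
Lemma W1_num p q : W1 theta (p, q) ->
  exists N, forall M, N <= M -> num theta p M = (num theta q M).+1.
Proof.
case=> /= _ _ [N [[N0 tail _] eq_lt eqN gtN]]; exists N; elim=> [|M IH].
  by rewrite leqNgt N0.
rewrite leq_eqVlt => /predU1P[eNM|NM].
  rewrite !numS -eNM eqN addnS; congr (_ * _ + _).+1; apply: eq_num => n /andP[_ nM].
  by rewrite eq_lt // eNM.
have M0 : 0 < M by exact: leq_trans N0 NM.
by rewrite !numS IH // gtN // tail //=; have := htheta M0; nia.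
Qed.

Lemma W2P h : W2 theta h <-> primary theta h /\ forall q, ~ W1 theta (h, q).
Proof.
split=> [[prim noW]|[prim noW]]; split=> //.
  by move=> q /noW[].
move=> [p q] W; split=> /= e; first by apply: (noW q); rewrite e.
by case: W => _ /= + _; rewrite -e; exact: primary_not_secondary.
Qed.

End AuxiliaryFunctions.

(** * Limits of sums and sub-products *)

Section Base.

Context (theta : nat -> nat) (htheta : forall n : nat, 0 < n -> 2 <= theta n).
Context (R : realType).

Local Open Scope classical_set_scope.
Local Open Scope ring_scope.

Local Notation den := (den theta).
Local Notation num := (num theta).
Local Notation psum := (psum theta R).
Local Notation usum := (usum theta R).

Lemma psum_add_cvg f g h (x y : R) :
  (forall n, (0 < n)%N -> f n = (g n + h n)%N) ->
  psum g @ \oo --> x -> psum h @ \oo --> y -> psum f @ \oo --> x + y.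
Proof.
move=> fgh gx hy; have -> : psum f = (fun N => psum g N + psum h N).
  apply/funext => N; rewrite /psum (num_add _ _ fgh) natrD mulrDl //.
exact: cvgD.
Qed.

Lemma psum_sum f N : psum f N = \sum_(1 <= n < N.+1) (f n)%:R / (den n)%:R.
Proof.
elim: N => [|N IH]; first by rewrite big_geq // /psum mul0r.
by rewrite psumS // IH [RHS]big_nat_recr.
Qed.

Lemma psum_sub_prod f g N : psum (sub_prod theta f g) N =
  \sum_(1 <= n < N.+1) \sum_(1 <= k < N.+1)
    (f n)%:R * (g k)%:R * ((Defs.Rmax theta n k N)%:R / (den N)%:R).
Proof.
rewrite /psum num_sub_prod // natr_sum mulr_suml; apply: eq_bigr => n _.
rewrite natr_sum mulr_suml; apply: eq_bigr => k _.
by rewrite !natrM mulrA.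
Qed.

Lemma psum_mul f g N K : psum f N * psum g K =
  \sum_(1 <= n < N.+1) \sum_(1 <= k < K.+1)
    (f n)%:R * (g k)%:R * ((den n)%:R^-1 / (den k)%:R).
Proof.
rewrite !psum_sum mulr_suml; apply: eq_bigr => n _.
rewrite mulr_sumr; apply: eq_bigr => k _; ring.
Qed.

Lemma Rmax_den_le n k N :
  (Defs.Rmax theta n k N)%:R / (den N)%:R <= (den n)%:R^-1 / (den k)%:R :> R.
Proof.
have := denR_gt0 htheta R; move=> d0; rewrite -invfM -[leRHS]mul1r.
rewrite ler_pdivrMr // mulrAC ler_pdivlMr ?mulr_gt0 // mul1r -!natrM ler_nat.
by rewrite Rmax_divn // leq_divM.
Qed.

Lemma Rmax_den_ge n k N :
  (den n)%:R^-1 / (den k)%:R - (den N)%:R^-1 <=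
  (Defs.Rmax theta n k N)%:R / (den N)%:R :> R.
Proof.
have := denR_gt0 htheta R; move=> d0; rewrite lerBlDr -invfM -[leLHS]mul1r.
rewrite -[X in _ + X]mul1r -mulrDl.
rewrite ler_pdivrMr ?mulr_gt0 // mulrAC ler_pdivlMr // mul1r -!natrM.
rewrite natr1 -natrM ler_nat Rmax_divn // ltnW // mulnC.
by rewrite mulnC -ltn_divLR ?muln_gt0 ?den_gt0.
Qed.

(** Each coefficient [Rmax]/[den N] lies below 1/([den n] [den k]), which bounds the limit from
    above. From below, compare with a fixed square block of indices, let [N] grow, then enlarge the
    block. *)
Lemma psum_sub_prod_cvg f g (x y : R) : psum f @ \oo --> x ->
  psum g @ \oo --> y -> psum (sub_prod theta f g) @ \oo --> x * y.
Proof.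
move=> fx gy.
have le_xy N : psum (sub_prod theta f g) N <= x * y.
  apply: (@le_trans _ _ (psum f N * psum g N)).
    rewrite psum_sub_prod psum_mul; apply: ler_sum => n _; apply: ler_sum => k _.
    by rewrite ler_wpM2l ?mulr_ge0 ?ler0n // Rmax_den_le.
  by rewrite ler_pM ?psum_ge0 // psum_le_lim.
have [l fgl] := bounded_psum_cvg htheta le_xy.
suff -> : x * y = l by [].
apply: le_anti; rewrite (lim_psum_le fgl le_xy) andbT.
apply: cvgr_to_le (cvgM fx gy) _; near=> K => /=.
(* Each coefficient falls short by at most 1/[den N], so [C]/[den N] bounds the error over the whole
   block. *)
pose C : R := \sum_(1 <= n < K.+1) \sum_(1 <= k < K.+1) (f n)%:R * (g k)%:R.
have lim_C : psum f K * psum g K - C * (den N)%:R^-1 @[N --> \oo] --> psum f K * psum g K.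
  rewrite -[X in _ --> X]subr0 -(mulr0 C); apply: cvgB; first exact: cvg_cst.
  by apply: cvgMr; exact: inv_den_cvg0.
apply: cvgr_to_le lim_C _; exists K => // N /= KN.
apply: le_trans (psum_le_lim htheta N fgl); rewrite psum_mul psum_sub_prod.
(* Only indices up to [K] are kept; the remaining terms are nonnegative. *)
rewrite mulr_suml -sumrB (@big_cat_nat _ _ _ K.+1 1 N.+1) //=.
rewrite -[leLHS]addr0 lerD //; last first.
  by apply: sumr_ge0 => n _; apply: sumr_ge0 => k _; rewrite !mulr_ge0 ?invr_ge0 ?ler0n.
apply: ler_sum => n _; rewrite mulr_suml -sumrB (@big_cat_nat _ _ _ K.+1 1 N.+1) //=.
rewrite -[leLHS]addr0 lerD //; last first.
  by apply: sumr_ge0 => k _; rewrite !mulr_ge0 ?invr_ge0 ?ler0n.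
apply: ler_sum => k _; rewrite -mulrBr ler_wpM2l ?mulr_ge0 ?ler0n //.
exact: Rmax_den_ge.
Unshelve. all: by end_near. Qed.

(** * The base set as sets of digit expansions of a given parity and value *)

Lemma W1_cvg p q (x : R) : W1 theta (p, q) ->
  (psum p @ \oo --> x) <-> (psum q @ \oo --> x).
Proof.
move=> W; have [N eqN] := W1_num htheta W.
have eq_near_pq : \forall M \near \oo, psum p M = psum q M + (den M)%:R^-1.
  by exists N => // M /= /eqN; rewrite -usumE // /psum /usum => ->.
split=> [px|qx].
  have lim : psum p M - (den M)%:R^-1 @[M --> \oo] --> x.
    by rewrite -[X in _ --> X]subr0; apply: cvgB; [exact: px|exact: inv_den_cvg0].
  apply: cvg_trans lim; apply: near_eq_cvg.
  by apply: filterS eq_near_pq => M /= ->; rewrite addrK.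
have lim : psum q M + (den M)%:R^-1 @[M --> \oo] --> x.
  by rewrite -[X in _ --> X]addr0; apply: cvgD; [exact: qx|exact: inv_den_cvg0].
apply: cvg_trans lim; apply: near_eq_cvg.
by apply: filterS eq_near_pq => M /= ->.
Qed.

Lemma digits_bounds h (x : R) N : digits theta h -> psum h @ \oo --> x ->
  (0 < N)%N -> psum h N <= x <= usum h N.
Proof.
move=> dh hx N0; rewrite psum_le_lim //=; apply: lim_psum_le hx _ => M.
apply: le_trans (nondecreasing_psum htheta R h (leq_maxr N M)) _.
apply: le_trans (ltW (psum_lt_usum htheta R _ _)) _.
by apply: usum_le => //; [rewrite N0 leq_maxl|move=> n /andP[n2 _]; exact: dh].
Qed.

(** A later digit that is not maximal makes the upper bound drop strictly, so the numerators of a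
    primary function are exact floors and determine its digits. *)
Lemma primary_bounds h (x : R) N : primary theta h -> psum h @ \oo --> x ->
  (0 < N)%N -> psum h N <= x < usum h N.
Proof.
move=> [dh prim] hx N0; rewrite psum_le_lim //=.
have [[|M] [] // NM neq] := prim N N0.
have /andP[_ /le_lt_trans] := digits_bounds dh hx (ltn0Sn M); apply.
have M0 : (0 < M)%N by exact: leq_trans N0 NM.
apply: (@lt_le_trans _ _ (usum h M)); last first.
  by apply: usum_le => //; [rewrite N0|move=> n /andP[n2 _]; exact: dh].
by rewrite (lt_leif (usum_step htheta R M0 _)); [exact/eqP|exact: (dh M.+1)].
Qed.

Lemma primary_uniq g h (x : R) : primary theta g -> primary theta h ->
  psum g @ \oo --> x -> psum h @ \oo --> x -> eq_pos g h.
Proof.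
move=> pg ph gx hx n n0.
have eq_n : num g n = num h n.
  by apply: num_uniq (primary_bounds pg gx n0) (primary_bounds ph hx n0).
apply: (digits_uniq htheta (N := n)) eq_n _ _; last by rewrite n0 leqnn.
  by move=> m /andP[m2 _]; case: pg => dg _; exact: dg.
by move=> m /andP[m2 _]; case: ph => dh _; exact: dh.
Qed.

Lemma digits_cvg h : digits theta h -> exists x : R, psum h @ \oo --> x.
Proof.
move=> dh; apply: (@bounded_psum_cvg _ htheta _ _ (usum h 1)) => N.
apply: le_trans (nondecreasing_psum htheta R h (leq_maxr 1 N)) _.
apply: le_trans (ltW (psum_lt_usum htheta R _ _)) _.
by apply: usum_le => //; [rewrite leq_maxl|move=> n /andP[n2 _]; exact: dh].
Qed.

(** Intended as the element of the base set with absolute value [x]; [e] is the parity of the entry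
    at 0, [true] being the negative sign. *)
Definition expansions (e : bool) (x : R) : set (nat -> nat) :=
  [set h | [/\ digits theta h, odd (h 0%N) = e & psum h @ \oo --> x]].

Lemma sgn_odd f g : (sgn f = sgn g) <-> (odd (f 0%N) = odd (g 0%N)).
Proof. by rewrite /sgn; do 2!case: odd. Qed.

(** A primary expansion of [x] agrees with [p] by uniqueness. A secondary one has a partner of the
    same value, which again must agree with [p]. *)
Lemma F_expansions p q (x : R) : W1 theta (p, q) -> psum p @ \oo --> x ->
  [set h | exists r, [/\ W1 theta r, same_class r.1 p & h = r.1 \/ h = r.2]] =
  expansions (odd (p 0%N)) x.
Proof.
move=> W px; apply/seteqP; split=> h /=.
  case=> -[r s] /= [Wr [rp /sgn_odd odd_r]].
  have rx : psum r @ \oo --> x by rewrite (eq_pos_psum _ _ rp).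
  case: (Wr) => /= -[dr _] [ds _] _ [->|->]; split=> //.
    by rewrite -(W1_at0 Wr).
  exact/(W1_cvg x Wr).
case=> dh odd_h hx; have [prim|sec] := primary_or_secondary dh.
  have hp : eq_pos h p by apply: primary_uniq hx px => //; case: W.
  exists (h, set_at0 q (h 0%N)); split; [exact: W1_eq_fst W hp| |by left].
  by split=> //; exact/sgn_odd.
have [r Wr] := secondary_partner htheta sec.
have rp : eq_pos r p.
  by apply: (@primary_uniq _ _ x); [case: Wr|case: W|exact/(W1_cvg x Wr)|].
exists (r, h); split=> //; last by right.
by split=> //; apply/sgn_odd; rewrite /= (W1_at0 Wr).
Qed.

(** A secondary expansion of [x] would have a partner agreeing with [h], putting [h] into a pair of
    [W1]. *)
Lemma G2_expansions h (x : R) : W2 theta h -> psum h @ \oo --> x ->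
  [set h' | W2 theta h' /\ same_class h' h] = expansions (odd (h 0%N)) x.
Proof.
move=> Wh hx; apply/seteqP; split=> g /=.
  case=> -[[dg _] _] [gh /sgn_odd odd_g]; split=> //.
  by rewrite (eq_pos_psum _ _ gh).
have /W2P[prim_h noW] := Wh.
case=> dg odd_g gx; have [prim|sec] := primary_or_secondary dg.
  have gh : eq_pos g h by apply: primary_uniq gx hx.
  split; last by split=> //; exact/sgn_odd.
  apply/W2P; split=> // q /W1_eq_fst/(_ (eq_posC gh)); exact: noW.
have [r Wr] := secondary_partner htheta sec; have prim_r : primary theta r by case: Wr.
have hr : eq_pos h r by apply: primary_uniq hx _ => //; exact/(W1_cvg x Wr).
by have /noW := W1_eq_fst Wr hr.
Qed.

Lemma baseP b : base theta b <-> exists e (x : R), 0 <= x /\ b = expansions e x.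
Proof.
split=> [[[[p q] W ->]|[h Wh ->]]|[e [x [x0 ->]]]].
- have [x px] : exists x : R, psum p @ \oo --> x by apply: digits_cvg; case: W => -[].
  by exists (odd (p 0%N)), x; rewrite (F_expansions W px); split=> //;
    exact: lim_psum_ge0 px.
- have [x hx] : exists x : R, psum h @ \oo --> x by apply: digits_cvg; case: Wh => -[].
  by exists (odd (h 0%N)), x; rewrite (G2_expansions Wh hx); split=> //;
    exact: lim_psum_ge0 hx.
have [h [dh h0 hx]] := expansion htheta (nat_of_bool e) x0.
have -> : e = odd (h 0%N) by rewrite h0 oddb.
(* A secondary expansion, or a primary one with a partner, leads to [F]; a primary one without
   partner leads to [G2]. *)
have [prim|sec] := primary_or_secondary dh; last first.
  have [p Wp] := secondary_partner htheta sec; left; exists (p, h) => //.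
  by rewrite -(W1_at0 Wp) -(F_expansions Wp) //; exact/(W1_cvg x Wp).
have [[q Wq]|noW] := EM (exists q, W1 theta (h, q)).
  by left; exists (h, q) => //; rewrite -(F_expansions Wq hx).
have Wh : W2 theta h by apply/W2P; split=> // q W; apply: noW; exists q.
by right; exists h; rewrite // -(G2_expansions Wh hx).
Qed.

Lemma r_of_expansions e (x : R) : r_of theta (expansions e x) =
  [set f | odd (f 0%N) = e /\ psum f @ \oo --> x].
Proof.
apply/seteqP; split=> f /=.
  by case=> h [dh odd_h hx] /(lim_of_contract htheta hx)[-> fx].
case=> odd_f fx; have [h [dh h0 hx red]] := contract_to_expansion htheta fx.
by exists h => //; split=> //; rewrite h0.
Qed.

End Base.

(** * Real numbers as classes of functions with a given signed value *)

Section RealNumbers.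

Context (theta : nat -> nat) (htheta : forall n : nat, 0 < n -> 2 <= theta n).
Context (R : realType).

Local Open Scope classical_set_scope.
Local Open Scope ring_scope.

Local Notation psum := (psum theta R).

Definition sg (f : nat -> nat) : R := (-1) ^+ odd (f 0%N).

(** As [sg f] is its own inverse, this says that [sg f] times the sum of the series is [y]. For
    [y = 0] both signs qualify, matching the union that defines [zeroR]. *)
Definition real_class (y : R) : set (nat -> nat) :=
  [set f | psum f @ \oo --> sg f * y].

Lemma sgM f : sg f * sg f = 1.
Proof. by rewrite /sg; case: odd; rewrite ?mulrNN mul1r. Qed.

Lemma real_class_abs f y : real_class y f -> sg f * y = `|y|.
Proof.
move=> fy; have fy0 : 0 <= sg f * y by exact: (@lim_psum_ge0 _ htheta R f).
rewrite -[LHS]ger0_norm //.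
by rewrite normrM /sg normrX normrN1 expr1n mul1r.
Qed.

Lemma real_classE f y : real_class y f -> y = sg f * `|y|.
Proof. by move/real_class_abs <-; rewrite mulrA sgM mul1r. Qed.

Lemma real_class_cvg f y : real_class y f -> psum f @ \oo --> `|y|.
Proof. by move=> fy; rewrite -(real_class_abs fy). Qed.

Lemma cvg_real_class f (y : R) : 0 <= y -> psum f @ \oo --> y ->
  real_class (sg f * y) f.
Proof. by move=> y0 fy; rewrite /real_class /= mulrA sgM mul1r. Qed.

Lemma real_class_uniq f y z : real_class y f -> real_class z f -> y = z.
Proof.
move=> fy fz; rewrite (real_classE fy) (real_classE fz); congr (_ * _).
exact: psum_cvg_unique (real_class_cvg fy) (real_class_cvg fz).
Qed.

Lemma real_class_inj y z : real_class y = real_class z ->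
  (exists f, real_class y f) -> y = z.
Proof. by move=> yz [f fy]; apply: (@real_class_uniq f) => //; rewrite -yz. Qed.

Lemma real_class_digits y : exists2 h, digits theta h & real_class y h.
Proof.
have [h [dh h0 hy]] := expansion htheta (nat_of_bool (y < 0)) (normr_ge0 y).
exists h => //; rewrite {1}[y]numEsign; have -> : (-1) ^+ (y < 0)%R = sg h.
  by rewrite /sg h0 oddb.
exact: cvg_real_class.
Qed.

Lemma real_class_primary y : exists2 h, primary theta h & real_class y h.
Proof.
have [h dh hy] := real_class_digits y.
have [prim|sec] := primary_or_secondary dh; first by exists h.
have [p Wp] := secondary_partner htheta sec; exists p; first by case: Wp.
by rewrite /real_class /= /sg (W1_at0 Wp); apply/(W1_cvg htheta _ Wp).
Qed.

Lemma odd_real_class f (y : R) : y != 0 -> real_class y f -> odd (f 0%N) = (y < 0).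
Proof.
move=> y0 /real_classE ->; have : 0 < `|y| by rewrite normr_gt0.
by rewrite /sg; case: odd; rewrite ?expr1 ?expr0 ?mulN1r ?mul1r ?oppr_lt0 => //
  /ltW; rewrite ltNge => ->.
Qed.

Lemma sg_real_class f g (y : R) :
  y != 0 -> real_class y f -> real_class y g -> sg f = sg g.
Proof.
by move=> y0 fy gy; rewrite /sg (odd_real_class y0 fy) (odd_real_class y0 gy).
Qed.

Lemma psum_eq0_cvg f : eq_pos f zero_fun -> psum f @ \oo --> (0 : R).
Proof.
move=> f0; rewrite (eq_pos_psum _ _ f0).
have -> : psum zero_fun = (fun=> 0); last exact: cvg_cst.
apply/funext; elim=> [|N IH]; first by rewrite /psum /= mul0r.
by rewrite psumS // IH mul0r addr0.
Qed.

Lemma neg_zero_pos : eq_pos neg_zero_fun zero_fun.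
Proof. by case. Qed.

Lemma expansions_zero e (x : R) :
  expansions theta e x zero_fun \/ expansions theta e x neg_zero_fun <-> x = 0.
Proof.
split=> [[] [_ _ zx]|->].
- by apply: psum_cvg_unique zx _; exact: psum_eq0_cvg.
- by apply: psum_cvg_unique zx _; exact: psum_eq0_cvg neg_zero_pos.
have dz h : eq_pos h zero_fun -> digits theta h.
  move=> h0 k k2; rewrite h0 ?(ltnW k2) //.
  by apply: leq_trans (htheta _); case: k k2 => [|[]].
case: e; [right|left]; split=> //; try exact: psum_eq0_cvg; try exact: dz.
  by apply: dz; exact: neg_zero_pos.
by apply: psum_eq0_cvg; exact: neg_zero_pos.
Qed.

Lemma zeroR_class : zeroR theta = real_class 0.
Proof.
apply/seteqP; split=> f; rewrite /real_class /= mulr0.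
  case=> b [/(baseP htheta R)[e [x [_ ->]]] /expansions_zero -> ].
  by rewrite r_of_expansions // => -[].
move=> f0; exists (expansions theta (odd (f 0%N)) (0 : R)); split.
- by apply/(baseP htheta R); exists (odd (f 0%N)), 0.
- exact/expansions_zero.
- by rewrite r_of_expansions.
Qed.

Lemma r_of_expansions_class e (x : R) : 0 < x ->
  r_of theta (expansions theta e x) = real_class ((-1) ^+ e * x).
Proof.
move=> x0; rewrite r_of_expansions //; apply/seteqP; split=> f /=.
  by case=> odd_f fx; rewrite /real_class /= /sg odd_f mulrA -signr_addb addbb mul1r.
move=> fx; have ex0 : (-1) ^+ e * x != 0 by rewrite mulf_neq0 ?signr_eq0 ?gt_eqF.
split; last by have := real_class_cvg fx; rewrite normrM normr_sign mul1r gtr0_norm.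
by rewrite (odd_real_class ex0 fx); case: e {fx ex0};
  rewrite ?mulN1r ?mul1r ?oppr_lt0 // ltNge ltW.
Qed.

(** This turns statements about [SR] into statements about signed values: each operation need only
    be computed on classes [real_class y]. *)
Lemma SRP X : SR theta X <-> exists y, X = real_class y.
Proof.
split=> [[[b [/(baseP htheta R)[e [x [x0 ->]]] nz nnz ->]]|->]|[y ->]].
- exists ((-1) ^+ e * x); apply: r_of_expansions_class.
  rewrite lt_neqAle x0 andbT eq_sym; apply/eqP => /(expansions_zero e).
  by case.
- by exists 0; exact: zeroR_class.
have [->|y0] := eqVneq y 0; first by right; rewrite zeroR_class.
have ay0 : 0 < `|y| by rewrite normr_gt0.
left; exists (expansions theta (y < 0) `|y|); split.
- by apply/(baseP htheta R); exists (y < 0), `|y|.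
- by move=> z; move/eqP: (proj1 (expansions_zero _ _) (or_introl z)); rewrite gt_eqF.
- by move=> z; move/eqP: (proj1 (expansions_zero _ _) (or_intror z)); rewrite gt_eqF.
- by rewrite r_of_expansions_class // -numEsign.
Qed.

Lemma cls_real_class f y : real_class y f -> cls theta f = real_class y.
Proof.
move=> fy; apply: xget_unique; first by split=> //; apply/SRP; exists y.
by move=> _ [/SRP[z ->] fz]; rewrite (real_class_uniq fz fy).
Qed.

Lemma rep_real_class y : real_class y (rep (real_class y)).
Proof.
by have [h _ hy] := real_class_digits y; apply: xgetI hy.
Qed.

Lemma real_class_eq y z : (real_class y = real_class z) <-> y = z.
Proof.
split=> [yz|-> //]; apply: real_class_inj yz _.
by exists (rep (real_class y)); exact: rep_real_class.
Qed.

Lemma absR_real_class (y : R) : absR theta (real_class y) = real_class `|y|.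
Proof.
apply: cls_real_class; have fy := @rep_real_class y.
set f := rep _ in fy *; rewrite /real_class /= /sg expr0 mul1r.
rewrite (@eq_pos_psum _ _ _ f); first exact: real_class_cvg.
by case.
Qed.

Lemma sgnR_real_class (y : R) : 0 < y -> sgnR (real_class y) = 1%N.
Proof.
move=> y0; have := @rep_real_class y; rewrite /sgnR /sgn => /odd_real_class ->.
  by rewrite ltNge ltW.
by rewrite gt_eqF.
Qed.

(** Stated for nonnegative values, since addition compares absolute values. Domination of entries
    passes to limits; conversely, an expansion of the difference is added to a representative. *)
Lemma leR_real_class (y z : R) : 0 <= y -> 0 <= z ->
  leR theta (real_class y) (real_class z) <-> y <= z.
Proof.
rewrite /leR zeroR_class le_eqVlt => /predU1P[<-|y0] z0.
  split=> // _; move: z0; rewrite le_eqVlt => /predU1P[<-|z0]; first by constructor 4.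
  constructor 3; split=> //; last exact: sgnR_real_class.
  by move/real_class_eq/eqP; rewrite gt_eqF.
have y_neq : real_class y <> real_class 0 by move/real_class_eq/eqP; rewrite gt_eqF.
move: z0; rewrite le_eqVlt => /predU1P[<-|z0].
  rewrite leNgt y0; split=> // -[[_ //]|[_ _]|[]|[]] //.
  by rewrite sgnR_real_class.
have z_neq : real_class z <> real_class 0 by move/real_class_eq/eqP; rewrite gt_eqF.
rewrite !sgnR_real_class //; split.
  case=> [[_ _ [//|[_ _ le_yz]|[]//]]|[]//|[]//|[]//].
  have fy := @rep_real_class y; have [g gz le_fg] := le_yz _ fy.
  have := real_class_cvg fy; have := real_class_cvg gz.
  rewrite !gtr0_norm // => {}gz {}fy.
  apply: lim_psum_le fy _ => N; apply: le_trans (psum_le_lim htheta N gz).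
  by rewrite ler_pM2r ?invr_gt0 ?denR_gt0 // ler_nat leq_num.
move=> le_yz; constructor 1; split=> //; constructor 2; split=> // f fy.
have zy : 0 <= z - y by rewrite subr_ge0.
(* Adding the digits [d] of [z - y] to [f] gives a function of value [z] dominating [f]
   entrywise. *)
have [d [_ _ dx]] := expansion htheta 0%N zy.
pose g k := if k is k'.+1 then (f k + d k)%N else f 0%N.
exists g; last by case=> // n _; rewrite leq_addr.
have -> : z = sg g * (y + (z - y)).
  rewrite [y + _]addrC subrK; have := odd_real_class _ fy.
  by rewrite gt_eqF // => /(_ isT); rewrite /sg /= => ->; rewrite ltNge ltW // mul1r.
apply: cvg_real_class; first by rewrite [y + _]addrC subrK ltW.
apply: (@psum_add_cvg _ _ _ f d) => //; first by case.
by rewrite -[y]gtr0_norm //; exact: real_class_cvg.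
Qed.

Lemma psum_sub_cvg f g h (x y : R) :
  (forall n, (0 < n)%N -> f n = (g n + h n)%N) ->
  psum f @ \oo --> x -> psum g @ \oo --> y -> psum h @ \oo --> x - y.
Proof.
move=> fgh fx gy; have -> : psum h = (fun N => psum f N - psum g N).
  by apply/funext => N; rewrite /psum (num_add _ _ fgh) natrD mulrDl addrC addKr.
exact: cvgB.
Qed.

(** * Tracking functions represent the difference of absolute values *)

Section Tracking.

Context (f g : nat -> nat) (y z : R).
Context (fy : real_class y f) (gz : real_class z g) (lt_zy : `|z| < `|y|).

Let x := sg f * (`|y| - `|z|).

Lemma tracking_sub : tracking theta f g `<=` real_class x.
Proof.
move=> r [w []]; rewrite (cls_real_class fy) => wy le_gw r0 rE.
have y0 : y != 0 by rewrite -normr_gt0 (le_lt_trans _ lt_zy).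
rewrite /x (sg_real_class y0 fy wy); have -> : sg w = sg r by rewrite /sg r0.
apply: cvg_real_class; first by rewrite subr_ge0 ltW.
apply: (@psum_sub_cvg w g); [|exact: real_class_cvg wy|exact: real_class_cvg gz].
by move=> n n0; rewrite rE // subnKC // le_gw.
Qed.

(** [g] plus an expansion of the difference has absolute value [|y|], so with the entry of [f] at 0
    it is a representative of the class of [f] dominating [g]. *)
Lemma tracking_nonempty : exists r, tracking theta f g r.
Proof.
have [|d [_ _ dx]] := @expansion _ htheta R (`|y| - `|z|) 0%N.
  by rewrite subr_ge0 ltW.
pose w k := if k is k'.+1 then (g k + d k)%N else f 0%N.
exists (fun k => if k is k'.+1 then d k else f 0%N); exists w; split=> //.
- rewrite (cls_real_class fy) (real_classE fy); have -> : sg f = sg w by [].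
  apply: cvg_real_class; rewrite ?normr_ge0 //.
  rewrite (_ : `|y| = `|z| + (`|y| - `|z|)); last by rewrite addrC subrK.
  by apply: psum_add_cvg (real_class_cvg gz) dx; case.
- by case=> // n _; rewrite leq_addr.
- by case=> // n _; rewrite addKn.
Qed.

Lemma primary_tracking_class : real_class x (primary_tracking theta f g).
Proof.
have trackE : trackingR theta f g = real_class x.
  apply: xget_unique; first by split; [apply/SRP; exists x|exact: tracking_sub].
  (* An actual tracking function excludes every other class; an empty set would be contained in all
     of them. *)
  move=> _ [/SRP[t ->] sub_t]; have [r tr] := tracking_nonempty.
  by rewrite (real_class_uniq (sub_t _ tr) (tracking_sub tr)).
have [_ hx] : [set h | primary theta h /\ real_class x h]
    (primary_rep theta (real_class x)).
  by have [h ph hx] := real_class_primary x; apply: xgetPex; exists h.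
have -> : x = sg (primary_tracking theta f g) * (`|y| - `|z|) by [].
apply: cvg_real_class; first by rewrite subr_ge0 ltW.
rewrite (@eq_pos_psum _ _ _ (primary_rep theta (real_class x))); last first.
  by case=> // n _; rewrite /primary_tracking trackE.
have := real_class_cvg hx.
by rewrite /x normrM normr_sign mul1r ger0_norm // subr_ge0 ltW.
Qed.

End Tracking.

(** Either the smaller summand is 0, or both are nonzero and then failure of the first branch of
    [sub_sum] forces opposite signs. *)
Lemma add_opposite f g y z : real_class y f -> real_class z g ->
  ~ [/\ sgn f = sgn g, ~ zeroR theta f & ~ zeroR theta g] ->
  `|z| <= `|y| -> y + z = sg f * (`|y| - `|z|).
Proof.
move=> fy gz opp le_zy; have [z0|z0] := eqVneq z 0.
  by rewrite z0 normr0 subr0 addr0 -real_classE.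
have y0 : y != 0 by rewrite -normr_gt0 (lt_le_trans _ le_zy) ?normr_gt0.
have neq_sg : sg g = - sg f.
  have : odd (f 0%N) <> odd (g 0%N).
    move/sgn_odd => eq_sgn; apply: opp; split=> //; rewrite zeroR_class.
      by move/(real_class_uniq fy)/eqP; rewrite (negPf y0).
    by move/(real_class_uniq gz)/eqP; rewrite (negPf z0).
  by rewrite /sg; do 2!case: odd => //; rewrite ?opprK.
by rewrite mulrBr -real_classE // {1}(real_classE gz) neq_sg mulNr.
Qed.

Lemma sub_sum_class f g y z : real_class y f -> real_class z g ->
  real_class (y + z) (sub_sum theta f g).
Proof.
move=> fy gz; rewrite /sub_sum; case: asboolP => [[/sgn_odd eq_odd _ _]|opp].
  (* With equal parities, the product of the entries at 0 has that same parity, so the sign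
     survives. *)
  set s := (X in real_class _ X); have sE : sg s = sg f.
    by rewrite /sg /s /= oddM -eq_odd andbb.
  have sgE : sg g = sg f by rewrite /sg eq_odd.
  rewrite /real_class /= sE mulrDr -{2}sgE.
  by apply: (@psum_add_cvg _ R _ f g) => //; case.
rewrite (cls_real_class fy) (cls_real_class gz) !absR_real_class.
case: asboolP => [/real_class_eq eq_yz|neq_yz].
  rewrite (add_opposite fy gz opp) ?eq_yz // subrr mulr0 /real_class /= mulr0.
  exact: psum_eq0_cvg.
have nle : leR theta (real_class `|y|) (real_class `|z|) <-> `|y| <= `|z|.
  by apply: leR_real_class; rewrite ?normr_ge0.
case: asboolP => [lt_zy|le_yz].
  have {}lt_zy : `|z| < `|y| by rewrite ltNge; apply/negP => /nle.
  by rewrite (add_opposite fy gz opp) ?ltW //; exact: primary_tracking_class.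
(* The default branch of [sub_sum]: the absolute values differ and the strict inequality fails,
   which by totality leaves the reverse one. *)
have lt_yz : `|y| < `|z|.
  rewrite lt_neqAle; apply/andP; split.
    by apply/eqP => e; apply: neq_yz; rewrite e.
  by apply/nle; apply: contrapT.
rewrite addrC (add_opposite gz fy) ?ltW //; first exact: primary_tracking_class.
by case=> eq_sgn ? ?; apply: opp.
Qed.

(** Entries at 0 are added, so parities add and signs multiply; absolute values multiply by
    [psum_sub_prod_cvg]. *)
Lemma sub_prod_class f g y z : real_class y f -> real_class z g ->
  real_class (y * z) (sub_prod theta f g).
Proof.
move=> fy gz; rewrite /real_class /=.
have -> : sg (sub_prod theta f g) = sg f * sg g.
  by rewrite /sg /sub_prod /= oddD signr_addb.
by rewrite mulrACA; exact: psum_sub_prod_cvg.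
Qed.

Lemma addR_class y z :
  addR theta (real_class y) (real_class z) = real_class (y + z).
Proof. by apply: cls_real_class; apply: sub_sum_class; exact: rep_real_class. Qed.

Lemma mulR_class y z :
  mulR theta (real_class y) (real_class z) = real_class (y * z).
Proof. by apply: cls_real_class; apply: sub_prod_class; exact: rep_real_class. Qed.

End RealNumbers.

Theorem mainTheorem13 (theta : nat -> nat)
    (htheta : forall n : nat, 0 < n -> 2 <= theta n)
    (f g w : set (nat -> nat))
    (hf : SR theta f) (hg : SR theta g) (hw : SR theta w) :
  mulR theta (addR theta f g) w = addR theta (mulR theta f w) (mulR theta g w).
Proof.
(* Replacing the three classes by their signed values reduces the claim to distributivity in the
   field of reals. *)
have SRP := SRP htheta Rdefinitions.R.
have [x ->] := proj1 (SRP f) hf.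
have [y ->] := proj1 (SRP g) hg.
have [z ->] := proj1 (SRP w) hw.
by rewrite !(addR_class htheta, mulR_class htheta) mulrDl.
Qed.
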